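(* Let $M\subseteq\mathbb{Z}^2$ be a submodule of rank $2$, generated by the rows of $\begin{pmatrix}a_1&a_2\\0&a_3\end{pmatrix}$ with $a_1>0$ and $0\le a_2<a_3$. Put $b_2=\gcd(a_2,a_3)$ and $b_3=a_1a_3/b_2$. Then the maximal compatible order ideals of $M$ are: (1) $\{(\alpha,\beta)\in\mathbb{N}^2\mid 0\le\alpha<a_1,\ 0\le\beta<a_3\}$; (2) $\{(\alpha,\beta)\in\mathbb{N}^2\mid 0\le\alpha<b_3,\ 0\le\beta<b_2\}$; (3) the differences of two rectangles $D(\mathrm{lcm}(P,Q)-(1,1))\setminus C(R)$, where $P=(p_1,p_2)$ and $Q=(q_1,q_2)$ are consecutive elements of $\mathcal{B}_2$ none of whose coordinates is zero, and $R=(p_1-q_1,q_2-p_2)$ if $p_1\ge q_1$ and $q_2\ge p_2$, while $R=(q_1-p_1,p_2-q_2)$ if $q_1\ge p_1$ and $p_2\ge q_2$.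
   Context: $\mathbb{N}$ denotes the non-negative integers. For $u,v\in\mathbb{N}^2$, $u\preceq v$ means componentwise $\le$; $D(u)=\{v\in\mathbb{N}^2\mid v\preceq u\}$, $C(u)=\{v\in\mathbb{N}^2\mid u\preceq v\}$; $\mathrm{lcm}(u,v)=(\max(u_1,v_1),\max(u_2,v_2))$. An order ideal is a subset $\mathcal{O}\subseteq\mathbb{N}^2$ with $D(u)\subseteq\mathcal{O}$ for all $u\in\mathcal{O}$; it is compatible (mod $M$) if $a,b\in\mathcal{O}$ and $a-b\in M$ imply $a=b$, and maximal compatible if it is compatible and maximal w.r.t. inclusion among compatible order ideals. $\mathcal{B}_2$ is the set of $\preceq$-minimal elements of $\{(p,q)\in\mathbb{N}^2\mid (p,-q)\in M\setminus\{0\}\}$. Two distinct elements $P,Q\in\mathcal{B}_2$ are consecutive if $\mathcal{B}_2\cap D(\mathrm{lcm}(P,Q))=\{P,Q\}$. *)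

(* Defs.v *)
(* MathComp, with the sets of mathcomp-classical. *)
From mathcomp Require Export all_boot all_order all_algebra.
From mathcomp Require Export boolp classical_sets.

Set Implicit Arguments.
Unset Strict Implicit.
Unset Printing Implicit Defensive.

Import Order.TTheory GRing.Theory Num.Theory.

Local Open Scope classical_set_scope.
Local Open Scope ring_scope.

(* N^2 carrying the product order: [(u <= v)%O] is componentwise [<=]. *)
Definition N2 := (nat *p nat)%type.

Definition toZ2 (u : N2) : int * int := (u.1%:Z, u.2%:Z).

Definition D (u : N2) : set N2 := [set v : N2 | (v <= u)%O].

Definition C (u : N2) : set N2 := [set v : N2 | (u <= v)%O].

Definition lcm2 (u v : N2) : N2 := (maxn u.1 v.1, maxn u.2 v.2).

Definition order_ideal (O : set N2) : Prop := forall u, O u -> D u `<=` O.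

Definition compatible (M : set (int * int)) (O : set N2) : Prop :=
  order_ideal O /\
  forall a b, O a -> O b -> M (toZ2 a - toZ2 b) -> a = b.

Definition maximal_compatible (M : set (int * int)) (O : set N2) : Prop :=
  compatible M O /\
  forall O', compatible M O' -> O `<=` O' -> O' = O.

Definition minimal_elements (S : set N2) : set N2 :=
  [set u | S u /\ forall v, S v -> (v <= u)%O -> v = u].

Definition B2 (M : set (int * int)) : set N2 :=
  minimal_elements [set u : N2 | (M `\ (0 : int * int)) (u.1%:Z, - u.2%:Z)].

Definition consecutive (M : set (int * int)) (P Q : N2) : Prop :=
  [/\ B2 M P, B2 M Q, P <> Q & B2 M `&` D (lcm2 P Q) = [set P; Q]].

Definition no_zero_coord (u : N2) : Prop := u.1 <> 0%N /\ u.2 <> 0%N.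

(* [u - (1,1)]; only meaningful when [u] has no zero coordinate, as the
   subtraction is truncated. *)
Definition sub11 (u : N2) : N2 := (u.1 - 1, u.2 - 1)%N.

(* The inequalities guarding each case make the truncated subtractions exact. *)
Definition is_corner (P Q R : N2) : Prop :=
  [/\ (Q.1 <= P.1)%N, (P.2 <= Q.2)%N & R = ((P.1 - Q.1)%N, (Q.2 - P.2)%N)] \/
  [/\ (P.1 <= Q.1)%N, (Q.2 <= P.2)%N & R = ((Q.1 - P.1)%N, (P.2 - Q.2)%N)].

(* Main.v *)
From mathcomp Require Import zify.
Require Import Defs.

Set Implicit Arguments.
Unset Strict Implicit.
Unset Printing Implicit Defensive.

Import Order.TTheory GRing.Theory Num.Theory.

Local Open Scope classical_set_scope.
Local Open Scope ring_scope.

(** An order ideal [O] fails to be compatible for one of two reasons: it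
contains a nonzero element [m] of [M] with nonnegative coordinates (congruent
to the origin), or it contains both [(p, 0)] and [(0, q)] for some nonzero
[(p, -q)] in [M], with [p] and [q] in N. Every violation reduces to one of
these, because two points of [O] that differ by [m], or by [(p, -q)], dominate
respectively [m] and the origin, or [(p, 0)] and [(0, q)].

The second obstruction only sees the width [w] of the bottom row and the
height [h] of the left column of [O]: it says that the half-open box
[0, w) x [0, h) contains no anti-point, that is, no point [(p, q)] of N^2 with
[(p, -q)] in [M] and nonzero. The first obstruction says that [O] avoids every
[C m], for [m] nonzero in the intersection of [M] with N^2. So, for given [w] and [h], there is a largest
compatible ideal, namely the box minus these cones ([box_ideal]), and the
maximal compatible ideals are the [box_ideal M w h] for the inclusion-maximal
boxes free of anti-points ([maximal_compatible_boxP]).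

A free box cannot be enlarged in either direction exactly when one minimal
anti-point [Q] stops its width and another one, [P], stops its height; then
[P] and [Q] are consecutive in [B2] and the box is [Q.1] by [P.2]
([consecutive_maximal_box], [maximal_box_consecutive]). In such a box all the
cones to be removed lie inside the single cone at
[(Q.1, - Q.2) - (P.1, - P.2)], since otherwise a translate of [(P.1, - P.2)] or
[(Q.1, - Q.2)] by an element of [M] would give an anti-point inside the box
([box_ideal_corner]).

There remain the boxes whose [P] or [Q] lies on an axis. Only one maximal box
has its height stopped by an anti-point on the vertical axis, and only one has
its width stopped on the horizontal axis. The explicit generators show that
these are [a1] by [a3] and [b3] by [b2], and that the difference of two points
of such a box is never a nonzero element of [M], so nothing is removed from
them: these are the two rectangles ([tall_maximal_box],
[wide_maximal_box]). *)

(** * Boxes and their ideals *)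

Definition sub_closed (M : set (int * int)) : Prop :=
  forall x y x' y', M (x, y) -> M (x', y') -> M (x - x', y - y').

(** Membership of [(p, q)] in the set whose minimal elements form [B2]; the
condition on [p + q] expresses that the vector is nonzero. *)
Definition anti_point (M : set (int * int)) (p q : nat) : Prop :=
  M (p%:Z, - q%:Z) /\ (0 < p + q)%N.

Definition pos_point (M : set (int * int)) (p q : nat) : Prop :=
  M (p%:Z, q%:Z) /\ (0 < p + q)%N.

Definition free_box (M : set (int * int)) (w h : nat) : Prop :=
  forall p q, anti_point M p q -> (p < w)%N -> (q < h)%N -> False.

(** As freeness is inherited by smaller boxes, it suffices to forbid growth by
one unit in each direction. *)
Definition maximal_box (M : set (int * int)) (w h : nat) : Prop :=
  [/\ (0 < w)%N, (0 < h)%N, free_box M w h,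
      ~ free_box M w.+1 h & ~ free_box M w h.+1].

Definition box_ideal (M : set (int * int)) (w h : nat) : set N2 :=
  [set u | [/\ (u.1 < w)%N, (u.2 < h)%N &
    forall p q, pos_point M p q -> (p <= u.1)%N -> (q <= u.2)%N -> False]].

Lemma le_N2 (u v : N2) : (u <= v)%O = (u.1 <= v.1)%N && (u.2 <= v.2)%N.
Proof. by []. Qed.

(** Gives the coordinates the type [nat] itself, where plain destructing gives
them the carrier of the order structure in the definition of [N2]. *)
Lemma N2_case (A : N2 -> Prop) : (forall p q : nat, A (p, q)) -> forall u, A u.
Proof. by move=> hA [p q]; apply: hA. Qed.

Lemma sub_toZ2 (u v : N2) :
  toZ2 u - toZ2 v = (u.1%:Z - v.1%:Z, u.2%:Z - v.2%:Z).
Proof. by []. Qed.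

Lemma sub_closedN (M : set (int * int)) x y :
  sub_closed M -> M (x, y) -> M (- x, - y).
Proof.
move=> hB hxy; have h0 := hB _ _ _ _ hxy hxy.
have := hB _ _ _ _ h0 hxy.
by rewrite !subrr !sub0r.
Qed.

(** Measures the bottom row and the left column of an ideal. *)
Lemma first_failure (A : nat -> Prop) (b : nat) :
  A 0%N -> ~ A b ->
  exists w, [/\ (0 < w)%N, ~ A w & forall p, (p < w)%N -> A p].
Proof.
move=> A0 Ab.
have ex : exists n, `[< ~ A n >] by exists b; apply/asboolP.
case: (ex_minnP ex) => w /asboolP Aw wmin; exists w; split => //.
- by case: w Aw {wmin} => // /(_ A0).
- move=> p pw; apply: contrapT => nA.
  by have := wmin p; rewrite leqNgt pw; move=> /(_ (asboolT nA)).
Qed.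

(** The difference of two congruent points has coordinates either of the same
sign, giving a removed cone containing one of the points, or of opposite signs,
giving an anti-point in the box. *)
Lemma box_ideal_compatible M w h :
  sub_closed M -> free_box M w h -> compatible M (box_ideal M w h).
Proof.
move=> hB hf; split.
  elim/N2_case=> u1 u2 /= [/= u1w u2h hu].
  elim/N2_case=> v1 v2; rewrite /D /= le_N2 /= => /andP[v1u v2u].
  split => /=; [lia | lia |] => p q hpq pv qv.
  by apply: (hu p q hpq) => /=; lia.
(* The relation is symmetric, so [b] may be taken to the left of [a]. *)
have key : forall a b, box_ideal M w h a -> box_ideal M w h b ->
    M (toZ2 a - toZ2 b) -> (b.1 <= a.1)%N -> a = b.
  elim/N2_case=> a1 a2; elim/N2_case=> b1 b2 [/= a1w a2h ha] [/= b1w b2h hb].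
  rewrite sub_toZ2 /= => hM b1a.
  have [b2a|a2b] := leqP b2 a2.
    have [s0|sp] := posnP (a1 - b1 + (a2 - b2))%N.
      by congr pair; lia.
    case: (ha (a1 - b1)%N (a2 - b2)%N); [split=> // | lia | lia].
    by have -> : ((a1 - b1)%N%:Z, (a2 - b2)%N%:Z) = (a1%:Z - b1%:Z, a2%:Z - b2%:Z)
      by congr pair; lia.
  case: (hf (a1 - b1)%N (b2 - a2)%N); [split=> //; [|lia] | lia | lia].
  by have -> : ((a1 - b1)%N%:Z, - (b2 - a2)%N%:Z) = (a1%:Z - b1%:Z, a2%:Z - b2%:Z)
    by congr pair; lia.
move=> a b ha hb hM; have [le|/ltnW le] := leqP b.1 a.1; first exact: key.
apply/esym/key => //.
have := sub_closedN hB hM.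
by rewrite !opprB.
Qed.

(** No removed cone reaches the axes inside a free box, because an element of
[M] on an axis is, up to sign, an anti-point. Hence the ideal of a free box
remembers its width and height. *)
Lemma bottom_row M w h p :
  free_box M w h -> (0 < h)%N -> (p < w)%N -> box_ideal M w h (p, 0%N).
Proof.
move=> hf h0 pw; split=> //= a b [hab sab] ap b0.
apply: (hf a 0%N); [|lia|lia]; split; last lia.
by have -> : - 0%N%:Z = b%:Z by lia.
Qed.

Lemma left_column M w h q :
  sub_closed M -> free_box M w h -> (0 < w)%N -> (q < h)%N ->
  box_ideal M w h (0%N, q).
Proof.
move=> hB hf w0 qh; split=> //= a b [hab sab] a0 bq.
apply: (hf 0%N b); [|lia|lia]; split; last lia.
have -> : 0%N%:Z = - a%:Z by lia.
exact: sub_closedN.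
Qed.

(** Take for [w] and [h] the lengths of the bottom row and of the left column,
finite because [O] cannot contain the two given elements of [M] on the axes. *)
Lemma compatible_sub_box M O b c :
  anti_point M b 0 -> anti_point M 0 c -> compatible M O -> O (0%N, 0%N) ->
  exists w h, [/\ free_box M w h, O `<=` box_ideal M w h,
    forall p, O (p, 0%N) -> (p < w)%N & forall q, O (0%N, q) -> (q < h)%N].
Proof.
move=> [hb b0] [hc c0] [hid hcomp] O0.
have down : forall u1 u2 v1 v2, O (u1, u2) -> (v1 <= u1)%N -> (v2 <= u2)%N ->
    O (v1, v2).
  by move=> u1 u2 v1 v2 hu h1 h2; apply: (hid _ hu); rewrite /D /= le_N2 /= h1 h2.
have nb : ~ O (b, 0%N).
  move=> hO; have := hcomp _ _ hO O0; rewrite sub_toZ2 /= !subr0.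
  by move=> /(_ hb) [] hb0; lia.
have nc : ~ O (0%N, c).
  move=> hO; have := hcomp _ _ O0 hO; rewrite sub_toZ2 /= !sub0r.
  by move=> /(_ hc) [] hb0; lia.
have [w [w0 Ow wmin]] := @first_failure (fun p => O (p, 0%N)) b O0 nb.
have [h [h0 Oh hmin]] := @first_failure (fun q => O (0%N, q)) c O0 nc.
have rowlt : forall p, O (p, 0%N) -> (p < w)%N.
  by move=> p Op; rewrite ltnNge; apply/negP => wp; apply: Ow; apply: down Op _ _.
have collt : forall q, O (0%N, q) -> (q < h)%N.
  by move=> q Oq; rewrite ltnNge; apply/negP => hq; apply: Oh; apply: down Oq _ _.
exists w, h; split=> //.
  move=> p q [hpq pq0] pw qh.
  have := hcomp _ _ (wmin _ pw) (hmin _ qh); rewrite sub_toZ2 /= subr0 sub0r.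
  by move=> /(_ hpq) [] hp hq; lia.
elim/N2_case=> u1 u2 hu; split=> /=.
- exact/rowlt/(down _ _ _ _ hu).
- exact/collt/(down _ _ _ _ hu).
move=> p q [hpq pq0] pu qu.
have := hcomp _ _ (down _ _ _ _ hu pu qu) O0; rewrite sub_toZ2 /= !subr0.
by move=> /(_ hpq) [] hp hq; lia.
Qed.

Lemma free_box_sub M w h w' h' :
  (w' <= w)%N -> (h' <= h)%N -> free_box M w h -> free_box M w' h'.
Proof. by move=> ww hh hf p q hpq pw qh; apply: (hf p q hpq); lia. Qed.

Lemma maximal_box_eq M w h w' h' :
  maximal_box M w h -> free_box M w' h' -> (w <= w')%N -> (h <= h')%N ->
  w' = w /\ h' = h.
Proof.
move=> [_ _ _ nw nh] hf ww hh.
have [lt|le] := ltnP w w'; first by case: nw; apply: free_box_sub hf.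
have [lt|le'] := ltnP h h'; first by case: nh; apply: free_box_sub hf.
by split; lia.
Qed.

Lemma box_ideal_le M w h w' h' :
  (w <= w')%N -> (h <= h')%N -> box_ideal M w h `<=` box_ideal M w' h'.
Proof. by move=> ww hh; elim/N2_case=> u1 u2 [/= *]; split=> //=; lia. Qed.

(** A maximal ideal equals the ideal of the free box that it spans, and that
box cannot grow since its ideal would then contain one more point of an axis.
Conversely, a compatible ideal above the ideal of a maximal box spans a free
box at least as wide and as high, hence the same one. *)
Lemma maximal_compatible_boxP M b c O :
  sub_closed M -> anti_point M b 0 -> anti_point M 0 c ->
  maximal_compatible M O <->
  exists w h, maximal_box M w h /\ O = box_ideal M w h.
Proof.
move=> hB hb hc; split.
  move=> [hcO hmax].
  (* A maximal ideal is nonempty: otherwise the unit box would enlarge it. *)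
  have f11 : free_box M 1 1 by move=> p q [_ pq0] ? ?; lia.
  have O0 : O (0%N, 0%N).
    apply: contrapT => nO0.
    have OE : O `<=` box_ideal M 1 1.
      move=> u hu; case: nO0; apply: (hcO.1 u hu).
      by rewrite /D /= le_N2.
    have E := hmax _ (box_ideal_compatible hB f11) OE.
    by apply: nO0; rewrite -E; apply: bottom_row.
  have [w [h [hf Osub wlt hlt]]] := compatible_sub_box hb hc hcO O0.
  have OE := hmax _ (box_ideal_compatible hB hf) Osub.
  have w0 := wlt _ O0; have h0 := hlt _ O0.
  exists w, h; split=> //; split=> // hf'.
    have E := hmax _ (box_ideal_compatible hB hf').
    have {}E : box_ideal M w.+1 h = O.
      by apply: E; apply: subset_trans Osub _; apply: box_ideal_le.
    by have := wlt w; rewrite -E ltnn; move=> /(_ (bottom_row hf' h0 (ltnSn w))).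
  have E := hmax _ (box_ideal_compatible hB hf').
  have {}E : box_ideal M w h.+1 = O.
    by apply: E; apply: subset_trans Osub _; apply: box_ideal_le.
  by have := hlt h; rewrite -E ltnn; move=> /(_ (left_column hB hf' w0 (ltnSn h))).
move=> [w [h [hm ->]]]; have [w0 h0 hf _ _] := hm.
split; first exact: box_ideal_compatible.
move=> O' hcO' sub.
have O'0 : O' (0%N, 0%N) by apply: sub; apply: bottom_row.
have [w' [h' [hf' O'sub wlt hlt]]] := compatible_sub_box hb hc hcO' O'0.
have ww : (w <= w')%N.
  have : (w.-1 < w')%N by apply/wlt/sub/bottom_row => //; lia.
  by lia.
have hh : (h <= h')%N.
  have : (h.-1 < h')%N by apply/hlt/sub/left_column => //; lia.
  by lia.
have [Ew Eh] := maximal_box_eq hm hf' ww hh.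
by apply/seteqP; split=> //; rewrite -Ew -Eh.
Qed.

(** * Maximal boxes and consecutive minimal elements *)

Lemma B2P M (u : N2) : B2 M u <->
  anti_point M u.1 u.2 /\
  forall p q, anti_point M p q -> (p <= u.1)%N -> (q <= u.2)%N -> (p, q) = u.
Proof.
have aP : forall v : N2, (M `\ (0 : int * int)) (v.1%:Z, - v.2%:Z) <->
    anti_point M v.1 v.2.
  elim/N2_case=> p q /=; split=> [[hM n0]|[hM pq0]]; split=> //.
    rewrite lt0n; apply/eqP => /eqP; rewrite addn_eq0 => /andP[/eqP p0 /eqP q0].
    by apply: n0; rewrite p0 q0.
  by move=> [] p0 q0; lia.
split=> [[hu hmin]|[hu hmin]].
  split; first exact/aP.
  move=> p q hpq pu qu; apply: (hmin (p, q)); first exact/(aP (p, q)).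
  by rewrite le_N2 pu qu.
split; first exact/aP.
elim/N2_case=> p q /aP hpq; rewrite le_N2 => /andP[pu qu]; exact: hmin.
Qed.

Lemma B2_below M p q :
  anti_point M p q ->
  exists u1 u2 : nat, [/\ B2 M (u1, u2), (u1 <= p)%N & (u2 <= q)%N].
Proof.
have [n] := ubnP (p + q)%N; elim: n p q => // n IH p q pqn hpq.
have [hu|nu] := pselect (B2 M (p, q)); first by exists p, q.
have [[p' q'] [hpq' le]] : exists v : nat * nat, anti_point M v.1 v.2 /\
    [/\ (v.1 <= p)%N, (v.2 <= q)%N & v <> (p, q)].
  apply: contrapT => nex; apply: nu; apply/B2P; split=> // p' q' hpq' pp qq.
  by apply: contrapT => ne; apply: nex; exists (p', q').
case: le => /= pp qq ne.
have lt : (p' + q' < n)%N.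
  have [E|/eqP] := eqVneq (p' + q')%N (p + q)%N; last by lia.
  by case: ne; congr pair; lia.
have [u1 [u2 [hu up uq]]] := IH _ _ lt hpq'.
by exists u1, u2; split=> //; lia.
Qed.

Lemma consecutiveC M P Q : consecutive M P Q -> consecutive M Q P.
Proof.
move=> [hP hQ ne E]; split=> //; first exact: nesym.
by rewrite setUC -E /lcm2 maxnC (maxnC Q.2).
Qed.

(** An anti-point in the box would dominate an element of [B2] below
[lcm2 P Q] and different from [P] and [Q]; and [P] and [Q] themselves obstruct
any enlargement. *)
Lemma consecutive_maximal_box M (P Q : N2) :
  consecutive M P Q -> (P.1 <= Q.1)%N -> (Q.2 <= P.2)%N ->
  [/\ (P.1 < Q.1)%N, (Q.2 < P.2)%N & maximal_box M Q.1 P.2].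
Proof.
elim/N2_case: P => p1 p2; elim/N2_case: Q => q1 q2.
move=> [/B2P[/= aP mP] /B2P[/= aQ mQ] ne E] /= pq qp.
have lt1 : (p1 < q1)%N.
  rewrite ltnNge; apply/negP => le; apply: ne; apply/esym.
  by apply: mP => //=.
have lt2 : (q2 < p2)%N.
  rewrite ltnNge; apply/negP => le; apply: ne.
  by apply: mQ => //=.
split=> //; split; try lia.
- move=> p q hpq pw qh; have [u1 [u2 [hu up uq]]] := B2_below hpq.
  have : (B2 M `&` D (lcm2 (p1, p2) (q1, q2))) (u1, u2).
    by split=> //; rewrite /D /= le_N2 /=; lia.
  by rewrite E => -[[? ?]|[? ?]]; lia.
- by move=> hf; apply: (hf _ _ aQ); lia.
- by move=> hf; apply: (hf _ _ aP); lia.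
Qed.

(** The minimal anti-points [P] and [Q] are those that obstruct the two
enlargements. Any element of [B2] below [(w, h)] lies outside the box, hence
has abscissa [w] or ordinate [h]; it is then comparable with [Q] or [P], so
equal to it. *)
Lemma maximal_box_consecutive M w h :
  maximal_box M w h ->
  exists P Q, [/\ consecutive M P Q, (P.1 < Q.1)%N, (Q.2 < P.2)%N,
                  Q.1 = w & P.2 = h].
Proof.
move=> [w0 h0 hf nw nh].
have [Q [hQ Ew lth]] : exists Q : N2, [/\ B2 M Q, Q.1 = w & (Q.2 < h)%N].
  apply: contrapT => nex; apply: nw => p q hpq pw qh.
  have [u1 [u2 [hu up uq]]] := B2_below hpq.
  apply: nex; exists (u1, u2); split=> //=; last by lia.
  have [ltw|] := ltnP u1 w; last by lia.
  by case: (hf u1 u2) => //; [case/B2P: hu | lia].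
have [P [hP Eh ltw]] : exists P : N2, [/\ B2 M P, P.2 = h & (P.1 < w)%N].
  apply: contrapT => nex; apply: nh => p q hpq pw qh.
  have [u1 [u2 [hu up uq]]] := B2_below hpq.
  apply: nex; exists (u1, u2); split=> //=; last by lia.
  have [lth'|] := ltnP u2 h; last by lia.
  by case: (hf u1 u2) => //; [case/B2P: hu | lia].
elim/N2_case: P hP Eh ltw => p1 p2 hP /= Eh ltw.
elim/N2_case: Q hQ Ew lth => q1 q2 hQ /= Ew lth.
exists (p1, p2), (q1, q2); split=> //=; try lia.
split=> //; first by move=> [] ? ?; lia.
apply/seteqP; split.
  elim/N2_case=> u1 u2 [hu]; rewrite /D /= le_N2 /= => /andP[le1 le2].
  have /B2P[aP mP] := hP; have /B2P[aQ mQ] := hQ; have /B2P[au mu] := hu.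
  move: aP mP aQ mQ au mu => /= aP mP aQ mQ au mu.
  have [ltu1|geu1] := ltnP u1 w.
    have [ltu2|geu2] := ltnP u2 h; first by case: (hf _ _ au).
    have [le|/ltnW le] := leqP u1 p1; first by left; apply: mP => //; lia.
    by left; apply/esym/mu => //; lia.
  have [le|/ltnW le] := leqP u2 q2; first by right; apply: mQ => //; lia.
  by right; apply/esym/mu => //; lia.
by move=> u [->|->]; split=> //; rewrite /D /= le_N2 /=; lia.
Qed.

(** The corner is the element of [M] given by the difference of the vectors
[(Q.1, - Q.2)] and [(P.1, - P.2)]. A nonzero element [(p, q)] of [M] lying in
the box but not above the corner gives the anti-point [(P.1 + p, P.2 - q)] or
[(Q.1 - p, Q.2 + q)] in the box, or is itself an anti-point there if it lies on
an axis. *)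
Lemma box_ideal_corner M (P Q : N2) :
  sub_closed M -> anti_point M P.1 P.2 -> anti_point M Q.1 Q.2 ->
  (P.1 < Q.1)%N -> (Q.2 < P.2)%N -> free_box M Q.1 P.2 ->
  box_ideal M Q.1 P.2 =
    D (sub11 (lcm2 P Q)) `\` C ((Q.1 - P.1)%N, (P.2 - Q.2)%N).
Proof.
elim/N2_case: P => p1 p2; elim/N2_case: Q => q1 q2 /=.
move=> hB [aP _] [aQ _] lt1 lt2 hf.
apply/seteqP; split.
  elim/N2_case=> u1 u2 [/= u1w u2h hu]; split.
    by rewrite /D /= le_N2 /=; lia.
  rewrite /C /= le_N2 /= => /andP[r1 r2].
  apply: (hu _ _ _ r1 r2); split; last lia.
  have := hB _ _ _ _ aQ aP.
  by congr M; congr pair; lia.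
elim/N2_case=> u1 u2 []; rewrite /D /C /= !le_N2 /= => /andP[le1 le2] nC.
split=> /=; [lia | lia |] => p q [hpq pq0] pu qu; apply: nC.
have hpq' := sub_closedN hB hpq.
have [le1'|lt1'] := leqP (q1 - p1) p; last first.
  have [q0|q0] := posnP q.
    case: (hf p 0%N); [split; last lia | lia | lia].
    by have -> : - 0%N%:Z = q%:Z by lia.
  case: (hf (p1 + p)%N (p2 - q)%N); [split; last lia | lia | lia].
  have := hB _ _ _ _ aP hpq'.
  by congr M; congr pair; lia.
have [le2'|lt2'] := leqP (p2 - q2) q; last first.
  have [p0|p0] := posnP p.
    case: (hf 0%N q); [split; last lia | lia | lia].
    by have -> : 0%N%:Z = - p%:Z by lia.
  case: (hf (q1 - p)%N (q2 + q)%N); [split; last lia | lia | lia].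
  have := hB _ _ _ _ aQ hpq.
  by congr M; congr pair; lia.
by apply/andP; split; lia.
Qed.

(** The roles of [P] and [Q] are exchanged in the two cases of [is_corner]. *)
Lemma consecutive_box_ideal M (P Q R : N2) :
  sub_closed M -> consecutive M P Q -> is_corner P Q R ->
  exists w h, maximal_box M w h /\
    D (sub11 (lcm2 P Q)) `\` C R = box_ideal M w h.
Proof.
move=> hB.
have ordered (P' Q' : N2) : consecutive M P' Q' -> (P'.1 <= Q'.1)%N ->
    (Q'.2 <= P'.2)%N -> exists w h, maximal_box M w h /\
      D (sub11 (lcm2 P' Q')) `\` C ((Q'.1 - P'.1)%N, (P'.2 - Q'.2)%N) =
      box_ideal M w h.
  move=> hPQ le1 le2; have [lt1 lt2 hm] := consecutive_maximal_box hPQ le1 le2.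
  exists Q'.1, P'.2; split=> //; have [_ _ hf _ _] := hm.
  have [/B2P[aP _] /B2P[aQ _] _ _] := hPQ.
  by rewrite (box_ideal_corner hB aP aQ).
move=> hPQ [] [le1 le2 ->]; last exact: ordered.
have -> : lcm2 P Q = lcm2 Q P by rewrite /lcm2 maxnC (maxnC P.2).
exact/ordered/le2/le1/consecutiveC.
Qed.

(** * The two rectangles *)

(** If no nonzero element of [M] is shorter than the sides of a box, the box is
free and meets no removed cone. The other two elements of [M] stop it from
growing. *)
Lemma rectangle_maximal_box M (a b p q : int) :
  0 < a -> 0 < b ->
  (forall x y : int, M (x, y) -> `|x| < a -> `|y| < b -> x = 0 /\ y = 0) ->
  0 <= q < b -> M (a, - q) -> 0 <= p < a -> M (p, - b) ->
  maximal_box M `|a| `|b| /\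
  box_ideal M `|a| `|b| = [set u : N2 | 0 <= u.1%:Z < a /\ 0 <= u.2%:Z < b].
Proof.
move=> a0 b0 triv qb haq pa hpb; split.
  split; try lia.
  - by move=> x y [hxy xy0] xa yb; have [] := triv _ _ hxy; lia.
  - move=> hf; apply: (hf `|a|%N `|q|%N); [split; last lia | lia | lia].
    by have -> : (`|a|%N%:Z, - `|q|%N%:Z) = (a, - q) by congr pair; lia.
  - move=> hf; apply: (hf `|p|%N `|b|%N); [split; last lia | lia | lia].
    by have -> : (`|p|%N%:Z, - `|b|%N%:Z) = (p, - b) by congr pair; lia.
apply/seteqP; split; elim/N2_case=> u1 u2.
  by move=> [/= ? ? _]; split; lia.
move=> [/= ? ?]; split=> /=; [lia | lia |] => x y [hxy xy0] xu yu.
by have [] := triv _ _ hxy; lia.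
Qed.

(** Each of two anti-points on the same axis lies outside both boxes, so the
boxes agree in that direction; they are then nested. *)
Lemma maximal_box_vertical M w h w' h' :
  maximal_box M w h -> maximal_box M w' h' ->
  anti_point M 0 h -> anti_point M 0 h' -> w = w' /\ h = h'.
Proof.
move=> hm hm' ha ha'; have [w0 _ hf _ _] := hm; have [w0' _ hf' _ _] := hm'.
have le1 : (h <= h')%N by rewrite leqNgt; apply/negP => lt; apply: (hf _ _ ha').
have le2 : (h' <= h)%N by rewrite leqNgt; apply/negP => lt; apply: (hf' _ _ ha).
have [le|/ltnW le] := leqP w w'.
  by have [-> ->] := maximal_box_eq hm hf' le le1.
by have [-> ->] := maximal_box_eq hm' hf le le2.
Qed.

Lemma maximal_box_horizontal M w h w' h' :
  maximal_box M w h -> maximal_box M w' h' ->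
  anti_point M w 0 -> anti_point M w' 0 -> w = w' /\ h = h'.
Proof.
move=> hm hm' ha ha'; have [_ h0 hf _ _] := hm; have [_ h0' hf' _ _] := hm'.
have le1 : (w <= w')%N by rewrite leqNgt; apply/negP => lt; apply: (hf _ _ ha').
have le2 : (w' <= w)%N by rewrite leqNgt; apply/negP => lt; apply: (hf' _ _ ha).
have [le|/ltnW le] := leqP h h'.
  by have [-> ->] := maximal_box_eq hm hf' le1 le.
by have [-> ->] := maximal_box_eq hm' hf le2 le.
Qed.

(** * The lattice given by its Hermite normal form *)

Lemma span2P (a1 a2 a3 : int) (x y : int) :
  inIntSpan [tuple (a1, a2); (0, a3)] (x, y) <->
  exists i j : int, x = i * a1 /\ y = i * a2 + j * a3.
Proof.
have pairMz (u : int * int) (i : int) : u *~ i = (i * u.1, i * u.2).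
  rewrite [LHS]surjective_pairing (raddfMz fst) (raddfMz snd).
  by rewrite -!mulrzz !(mulrzz, mulrC i).
split=> [[a]|[i [j [-> ->]]]].
  rewrite !big_ord_recl big_ord0 /= !pairMz => -[-> ->].
  by exists (a ord0), (a (lift ord0 ord0)); rewrite mulr0 !addr0.
exists [ffun k : 'I_2 => if k == ord0 then i else j].
rewrite !big_ord_recl big_ord0 /= !pairMz !ffunE /=.
by congr pair; rewrite ?mulr0 !addr0.
Qed.

Lemma small_multiple (i a : int) : `|i * a| < a -> i * a = 0.
Proof.
move=> lt; have [->|i0] := eqVneq i 0; first by rewrite mul0r.
have : a <= `|i * a| by rewrite normrM; nia.
by lia.
Qed.

Lemma span2_sub_closed (a1 a2 a3 : int) :
  sub_closed [set v | inIntSpan [tuple (a1, a2); (0, a3)] v].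
Proof.
move=> x y x' y' /span2P[i [j [-> ->]]] /span2P[i' [j' [-> ->]]].
by apply/span2P; exists (i - i'), (j - j'); split; lia.
Qed.

Lemma tall_maximal_box (a1 a2 a3 : int) :
  0 < a1 -> 0 <= a2 < a3 ->
  let M := [set v | inIntSpan [tuple (a1, a2); (0, a3)] v] in
  [/\ anti_point M 0 `|a3|, maximal_box M `|a1| `|a3| &
      box_ideal M `|a1| `|a3| =
        [set u : N2 | 0 <= u.1%:Z < a1 /\ 0 <= u.2%:Z < a3]].
Proof.
move=> ha1 ha23 M.
have h0 : M (0, - a3) by apply/span2P; exists 0, (-1); split; lia.
(* [- q] is the representative of [a2] modulo [a3] in (-a3, 0]. *)
have [q qb hq] : exists2 q, 0 <= q < a3 & M (a1, - q).
  have [a20|a20] := eqVneq a2 0.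
    by exists 0; [lia | apply/span2P; exists 1, 0; split; lia].
  by exists (a3 - a2); [lia | apply/span2P; exists 1, (-1); split; lia].
have triv x y : M (x, y) -> `|x| < a1 -> `|y| < a3 -> x = 0 /\ y = 0.
  move=> /span2P[i [j [-> ->]]] /small_multiple /eqP.
  rewrite mulf_eq0 => /orP[/eqP -> | /eqP]; last by lia.
  by rewrite !mul0r add0r => /small_multiple ->.
have ha3 : 0 < a3 by lia.
have p0 : 0 <= (0 : int) < a1 by lia.
have [box ideal] := rectangle_maximal_box ha1 ha3 triv qb hq p0 h0.
split=> //; split; last by lia.
by have -> : - `|a3|%N%:Z = - a3 by lia.
Qed.

(** Writing [a2 = c2 * b2] and [a3 = c3 * b2] with [u * c2 + v * c3 = 1], one
has [b3 = a1 * c3]. The second coordinates of [M] are the multiples of [b2],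
and an element on the horizontal axis satisfies [i * c2 + j * c3 = 0], whence
[c3] divides [i] and [b3] divides its first coordinate. *)
Lemma wide_maximal_box (a1 a2 a3 : int) :
  0 < a1 -> 0 < a3 ->
  let M := [set v | inIntSpan [tuple (a1, a2); (0, a3)] v] in
  let b2 := gcdz a2 a3 in
  let b3 := (a1 * a3 %/ b2)%Z in
  [/\ anti_point M `|b3| 0, maximal_box M `|b3| `|b2| &
      box_ideal M `|b3| `|b2| =
        [set u : N2 | 0 <= u.1%:Z < b3 /\ 0 <= u.2%:Z < b2]].
Proof.
move=> ha1 ha3 M b2 b3.
have b20 : 0 < b2 by rewrite lt_def gcdz_eq0 andbC /=; lia.
have [c2 Ec2] := dvdzP (dvdz_gcdl a2 a3); rewrite -/b2 in Ec2.
have [c3 Ec3] := dvdzP (dvdz_gcdr a2 a3); rewrite -/b2 in Ec3.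
have [u [v]] := Bezoutz a2 a3; rewrite -/b2 => bez.
have bez1 : u * c2 + v * c3 = 1.
  apply: (mulIf (lt0r_neq0 b20)).
  by rewrite mul1r mulrDl -!mulrA -Ec2 -Ec3.
have c30 : 0 < c3 by rewrite -(pmulr_lgt0 _ b20) -Ec3.
have Eb3 : b3 = a1 * c3 by rewrite /b3 Ec3 mulrA mulzK // lt0r_neq0.
have b30 : 0 < b3 by rewrite Eb3 mulr_gt0.
have h0 : M (b3, - 0) by apply/span2P; exists c3, (- c2); split; nia.
(* Bezout gives an element of [M] with second coordinate [- b2]; its first
   coordinate is reduced modulo [b3]. *)
have [p pb hp] : exists2 p, 0 <= p < b3 & M (p, - b2).
  pose k := ((- u * a1) %/ b3)%Z.
  exists ((- u * a1) %% b3)%Z; first by rewrite modz_ge0 ?ltz_pmod ?lt0r_neq0.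
  apply/span2P; exists (- u - k * c3), (- v + k * c2); split.
    have := divz_eq (- u * a1) b3; rewrite -/k Eb3; nia.
  rewrite -bez; nia.
have triv x y : M (x, y) -> `|x| < b3 -> `|y| < b2 -> x = 0 /\ y = 0.
  move=> /span2P[i [j [-> ->]]] hx.
  have -> : i * a2 + j * a3 = (i * c2 + j * c3) * b2 by nia.
  move=> /small_multiple y0; rewrite y0; split=> //.
  have {}y0 : i * c2 + j * c3 = 0.
    by apply: (mulIf (lt0r_neq0 b20)); rewrite mul0r.
  have Ex : i * a1 = (i * v - j * u) * b3.
    have y0' : i * c2 = - (j * c3) by lia.
    rewrite -[i in LHS]mulr1 -bez1.
    have -> : i * (u * c2 + v * c3) * a1 = (u * (i * c2) + i * v * c3) * a1.
      by lia.
    by rewrite y0' Eb3; lia.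
  by rewrite Ex; apply: small_multiple; rewrite -Ex.
have q0 : 0 <= (0 : int) < b2 by lia.
have [box ideal] := rectangle_maximal_box b30 b20 triv q0 h0 pb hp.
split=> //; split; last by lia.
by have -> : `|b3|%N%:Z = b3 by lia.
Qed.

Theorem proposition22 (M : set (int * int)) (a1 a2 a3 : int)
    (ha1 : 0 < a1) (ha2 : 0 <= a2) (ha23 : a2 < a3)
    (hM : M = [set v | inIntSpan [tuple (a1, a2); (0, a3)] v]) :
  let b2 : int := gcdz a2 a3 in
  let b3 : int := ((a1 * a3) %/ b2)%Z in
  forall O : set N2,
    maximal_compatible M O <->
    [\/ O = [set u : N2 | 0 <= u.1%:Z < a1 /\ 0 <= u.2%:Z < a3],
        O = [set u : N2 | 0 <= u.1%:Z < b3 /\ 0 <= u.2%:Z < b2]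
      | exists P Q R : N2,
          [/\ consecutive M P Q, no_zero_coord P, no_zero_coord Q,
              is_corner P Q R & O = D (sub11 (lcm2 P Q)) `\` C R]].
Proof.
move=> b2 b3 O.
have hB : sub_closed M by rewrite hM; apply: span2_sub_closed.
have [] := @tall_maximal_box a1 a2 a3; rewrite ?ha2 // -hM => a_tall tall <-.
have [] := @wide_maximal_box a1 a2 a3 ha1 (le_lt_trans ha2 ha23).
rewrite -hM -/b2 -/b3 => a_wide wide <-.
rewrite (maximal_compatible_boxP O hB a_wide a_tall); split; last first.
  move=> [->|->|[P [Q [R [hPQ _ _ hR ->]]]]].
  - by exists `|a1|%N, `|a3|%N.
  - by exists `|b3|%N, `|b2|%N.
  - by have [w [h [? ->]]] := consecutive_box_ideal hB hPQ hR; exists w, h.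
move=> [w [h [hm ->]]].
have [P [Q [hPQ lt1 lt2 Ew Eh]]] := maximal_box_consecutive hm.
have [/B2P[aP _] /B2P[aQ _] _ _] := hPQ.
have [P10|P1n] := eqVneq P.1 0%N.
  rewrite P10 Eh in aP.
  by have [-> ->] := maximal_box_vertical hm tall aP a_tall; constructor 1.
have [Q20|Q2n] := eqVneq Q.2 0%N.
  rewrite Q20 Ew in aQ.
  by have [-> ->] := maximal_box_horizontal hm wide aQ a_wide; constructor 2.
constructor 3; exists P, Q, ((Q.1 - P.1)%N, (P.2 - Q.2)%N); split=> //.
- split; first exact/eqP.
  by move=> P20; rewrite P20 in lt2.
- split; last exact/eqP.
  by move=> Q10; rewrite Q10 in lt1.
- by right; split=> //; apply: ltnW.
- have [_ _ hf _ _] := hm.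
  by rewrite -Ew -Eh (box_ideal_corner hB aP aQ) // Ew Eh.
Qed.
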